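(* Let $\{x_n\}$ and $\{y_n\}$ be two sequences in a cone metric space $(X,d)$ and let $\{y_n\}$ converge to $y\in X$. If there exists $r\in E$ with $0\ll r$ such that $d(x_i,y_i)\le r$ for all $i\in\mathbb{N}$, then $\{x_n\}$ is $r$-convergent to $y$.
   Context: Let $E$ be a real Banach space. A subset $P\subset E$ is a cone if (i) $P$ is closed, nonempty and $P\neq\{0\}$; (ii) $a,b\in\mathbb{R}$, $a,b\ge 0$, $x,y\in P$ implies $ax+by\in P$; (iii) $x\in P$ and $-x\in P$ implies $x=0$. Write $x\le y$ if $y-x\in P$, $x<y$ if $x\le y$ and $x\ne y$, and $x\ll y$ if $y-x\in \mathrm{int}\,P$ (the interior of $P$). A cone metric space $(X,d)$ (associated with $E$ and $P$) is a nonempty set $X$ with a map $d:X\times X\to E$ such that for all $x,y,z\in X$: $0\le d(x,y)$, and $d(x,y)=0$ iff $x=y$; $d(x,y)=d(y,x)$; $d(x,y)\le d(x,z)+d(z,y)$. A sequence $\{y_n\}$ in $X$ converges to $y\in X$ if for every $c\in E$ with $0\ll c$ there is $k\in\mathbb{N}$ such that $d(y_n,y)\ll c$ for all $n>k$. For $r\in E$ with $0\ll r$ or $r=0$, a sequence $\{x_n\}$ in $X$ is $r$-convergent to $x\in X$ if for every $\epsilon\in E$ with $0\ll\epsilon$ there is $k\in\mathbb{N}$ such that $d(x_n,x)\ll r+\epsilon$ for all $n\ge k$. *)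

(* Defs.v *)
From HB Require Import structures.
From mathcomp Require Import all_boot all_order all_algebra.
From mathcomp Require Import all_classical all_reals all_analysis.
Import numFieldNormedType.Exports.

Set Implicit Arguments.
Unset Strict Implicit.
Unset Printing Implicit Defensive.

Import Order.TTheory GRing.Theory Num.Theory.
Local Open Scope classical_set_scope.
Local Open Scope ring_scope.

Record is_cone (R : realType) (E : completeNormedModType R) (P : set E) :
    Prop := IsCone {
  cone_closed : closed P;
  cone_nonempty : P !=set0;
  cone_nontrivial : P <> [set 0];
  cone_comb : forall (a b : R) (x y : E),
    0 <= a -> 0 <= b -> P x -> P y -> P (a *: x + b *: y);
  cone_pointed : forall x : E, P x -> P (- x) -> x = 0
}.

Definition cone_le (R : realType) (E : completeNormedModType R) (P : set E)
  (x y : E) : Prop := P (y - x).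

(* The relation x << y. *)
Definition cone_ll (R : realType) (E : completeNormedModType R) (P : set E)
  (x y : E) : Prop := interior P (y - x).

Record is_cone_metric_space (R : realType) (E : completeNormedModType R)
    (P : set E) (X : Type) (d : X -> X -> E) : Prop := IsConeMetricSpace {
  cms_nonempty : inhabited X;
  cms_ge0 : forall x y : X, cone_le P 0 (d x y);
  cms_eq0 : forall x y : X, d x y = 0 <-> x = y;
  cms_sym : forall x y : X, d x y = d y x;
  cms_triangle : forall x y z : X, cone_le P (d x y) (d x z + d z y)
}.

Definition cone_converges (R : realType) (E : completeNormedModType R)
    (P : set E) (X : Type) (d : X -> X -> E) (u : nat -> X) (l : X) : Prop :=
  forall c : E, cone_ll P 0 c ->
    exists k : nat, forall n : nat, (k < n)%N -> cone_ll P (d (u n) l) c.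

(* The first conjunct is the range of roughness degrees r for which the notion
   is defined. *)
Definition r_convergent (R : realType) (E : completeNormedModType R)
    (P : set E) (X : Type) (d : X -> X -> E) (r : E) (u : nat -> X) (l : X) :
    Prop :=
  (cone_ll P 0 r \/ r = 0) /\
  forall e : E, cone_ll P 0 e ->
    exists k : nat, forall n : nat, (k <= n)%N -> cone_ll P (d (u n) l) (r + e).

(* Main.v *)
(** The difference [r + e - d (x_ n) y] is the sum of [e - d (y_ n) y], which
    lies in the interior of the cone for large [n], and of two elements of the
    cone: [r - d (x_ n) (y_ n)] and the defect in the triangle inequality
    through [y_ n].  Adding elements of the cone to an interior point gives an
    interior point. *)
Require Import Defs.
From HB Require Import structures.
From mathcomp Require Import all_boot all_order all_algebra.
From mathcomp Require Import all_classical all_reals all_analysis.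
Import numFieldNormedType.Exports.
Import GRing.Theory Num.Theory.
Local Open Scope classical_set_scope.
Local Open Scope ring_scope.

Lemma cone_add (R : realType) (E : completeNormedModType R) (P : set E)
    (hP : is_cone P) (a b : E) : P a -> P b -> P (a + b).
Proof.
move=> Pa Pb; rewrite -[a]scale1r -[b]scale1r.
exact: (cone_comb hP).
Qed.

(** The map [z - b] is continuous and sends [a + b] to [a], so it pulls the neighbourhood [P] of [a]
    back to a neighbourhood of [a + b]. Each [z] there is [(z - b) + b], a sum of two elements of
    [P]. *)
Lemma interior_cone_add (R : realType) (E : completeNormedModType R)
    (P : set E) (hP : is_cone P) (a b : E) :
  interior P a -> P b -> interior P (a + b).
Proof.
move=> Pa Pb.
have shift_cvg : (fun z : E => z - b) @ (a + b) --> a.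
  rewrite -{2}[a](addrK b).
  by apply: cvgB; [exact: cvg_id | exact: cvg_cst].
have : nbhs (a + b) [set z | P (z - b)] by exact: shift_cvg.
apply: filterS => z /= Pzb.
by rewrite -[z](subrK b); exact: cone_add.
Qed.

Theorem theorem3p3 (R : realType) (E : completeNormedModType R) (P : set E)
    (hP : is_cone P) (X : Type) (d : X -> X -> E)
    (hX : is_cone_metric_space P d) (x_ y_ : nat -> X) (y : X)
    (hy : cone_converges P d y_ y) (r : E) (hr : cone_ll P 0 r)
    (hxy : forall i : nat, cone_le P (d (x_ i) (y_ i)) r) :
  r_convergent P d r x_ y.
Proof.
split=> [|e /hy[k hk]]; first by left.
(* Convergence only controls the indices [n > k]. *)
exists k.+1 => n /hk yn_near.
have triangle := cms_triangle hX (x_ n) y (y_ n).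
rewrite /cone_ll.
have -> : r + e - d (x_ n) y = (e - d (y_ n) y) +
    ((r - d (x_ n) (y_ n)) + (d (x_ n) (y_ n) + d (y_ n) y - d (x_ n) y)).
  (* The sum telescopes: [d (x_ n) (y_ n)] cancels first, then [d (y_ n) y]. *)
  rewrite (addrA (r - _)) (addrA (r - _)) subrK.
  by rewrite (addrA (e - _)) addrACA addNr addr0 (addrC e).
by apply: interior_cone_add => //; apply: cone_add => //; exact: hxy.
Qed.
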